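(* Let $G$ be a finite simple undirected graph. The Gallai graph $\Gamma(G)$ of $G$ is a forest if and only if $G$ is chordal and contains none of the graphs $F_1,\ldots,F_9$ (described in the context) as an induced subgraph.
   Context: For a graph $G$, the Gallai graph $\Gamma(G)$ has vertex set $E(G)$, and two distinct edges $e,f$ of $G$ are adjacent in $\Gamma(G)$ if $e$ and $f$ share an endpoint in $G$ but do not span a triangle in $G$ (i.e., if $e=uv$, $f=vw$ with $u\neq w$, then $uw\notin E(G)$). A graph is chordal if it has no induced cycle of length at least $4$. The graphs $F_1,\dots,F_9$ are given by vertex sets and edge lists: $F_1$: vertices $1,2,3,4$; edges $14,24,34$ (the claw $K_{1,3}$). $F_2$: vertices $1,\dots,5$; edges $12,15,25,34,35,45$ (two triangles sharing one vertex). $F_3$: vertices $1,\dots,6$; edges $12,16,23,25,26,35,36,34,45,56$ (a $K_4$ on $\{2,3,5,6\}$, plus vertex $1$ adjacent exactly to $2,6$ and vertex $4$ adjacent exactly to $3,5$). $F_4$: vertices $1,\dots,6$; edges $12,23,34,25,35,56$ (a triangle $\{2,3,5\}$ with one pendant vertex attached to each triangle vertex). $F_5$: vertices $1,\dots,6$; edges $24,25,45,12,14,23,35,46,56$ (a triangle $\{2,4,5\}$ plus vertices $1,3,6$ adjacent exactly to $\{2,4\}$, $\{2,5\}$, $\{4,5\}$ respectively). $F_6$: vertices $1,\dots,6$; edges $12,23,34,45,26,36,46$. $F_7$: vertices $1,\dots,7$; edges $12,23,34,45,56,27,37,47,57$. $F_8$: vertices $1,\dots,7$; edges $12,15,25,26,56,23,36,37,67,34,47$.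 $F_9$: vertices $1,\dots,7$; edges $12,14,23,24,25,27,36,35,37,45,47,56,57$. ''Contains $H$ as an induced subgraph'' means some subset of vertices of $G$ induces a graph isomorphic to $H$. *)

(* Defs.v *)
From HB Require Import structures.
From mathcomp Require Import all_boot.

Set Implicit Arguments.
Unset Strict Implicit.
Unset Printing Implicit Defensive.

Record sgraph := SGraph {
  vertex :> finType;
  adj : rel vertex;
  adj_sym : symmetric adj;
  adj_irrefl : irreflexive adj
}.

Section GraphOfRel.
Variables (T : finType) (r : rel T).

Definition sym_rel : rel T := [rel x y | (x != y) && (r x y || r y x)].

Lemma sym_rel_sym : symmetric sym_rel.
Proof. by move=> x y; rewrite /sym_rel /= eq_sym orbC. Qed.

Lemma sym_rel_irrefl : irreflexive sym_rel.
Proof. by move=> x; rewrite /sym_rel /= eqxx. Qed.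

Definition graph_of_rel : sgraph := SGraph sym_rel_sym sym_rel_irrefl.
End GraphOfRel.

Section Induced.
Variables (G : sgraph) (S : {set G}).

Definition induced_adj : rel {x : G | x \in S} :=
  [rel x y | adj (val x) (val y)].

Lemma induced_adj_sym : symmetric induced_adj.
Proof. by move=> x y; exact: adj_sym. Qed.

Lemma induced_adj_irrefl : irreflexive induced_adj.
Proof. by move=> x; exact: adj_irrefl. Qed.

Definition induced : sgraph := SGraph induced_adj_sym induced_adj_irrefl.
End Induced.

Definition isomorphic (G H : sgraph) : Prop :=
  exists f : G -> H, bijective f /\ forall x y, adj (f x) (f y) = adj x y.

Definition contains_induced (G H : sgraph) : Prop :=
  exists S : {set G}, isomorphic (induced S) H.

(* A cycle is listed by its pairwise distinct vertices in cyclic order. The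
   size bound excludes [::], [:: x] and the back-and-forth walk [:: x; y],
   which also satisfy path.cycle. *)
Definition forest (G : sgraph) : Prop :=
  forall s : seq G, 3 <= size s -> uniq s -> ~ cycle (@adj G) s.

Definition cycle_graph (n : nat) : sgraph :=
  graph_of_rel [rel i j : 'I_n | j == i.+1 %% n :> nat].

Definition chordal (G : sgraph) : Prop :=
  forall n, 4 <= n -> ~ contains_induced G (cycle_graph n).

Section Gallai.
Variable G : sgraph.

Definition edges : {set {set G}} := [set [set x; y] | x in G, y in G & adj x y].

Definition gallai_adj : rel {e : {set G} | e \in edges} :=
  [rel e f | (e != f) && [exists u, exists v, exists w,
     [&& val e == [set u; v], val f == [set v; w], u != w & ~~ adj u w]]].

Lemma gallai_adj_sym : symmetric gallai_adj.
Proof.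
suff H e f : gallai_adj e f -> gallai_adj f e by move=> e f; apply/idP/idP; apply: H.
case/andP=> nef /existsP[u /existsP[v /existsP[w /and4P[ee ef nuw auw]]]].
rewrite /gallai_adj /= eq_sym nef; apply/existsP; exists w; apply/existsP; exists v.
by apply/existsP; exists u; rewrite setUC ef setUC ee eq_sym nuw adj_sym.
Qed.

Lemma gallai_adj_irrefl : irreflexive gallai_adj.
Proof. by move=> e; rewrite /gallai_adj /= eqxx. Qed.

Definition gallai : sgraph := SGraph gallai_adj_sym gallai_adj_irrefl.
End Gallai.

(* The vertex labelled k >= 1 in the edge list l is the ordinal k - 1. *)
Definition graph_of_edges (n : nat) (l : seq (nat * nat)) : sgraph :=
  graph_of_rel [rel i j : 'I_n | (i.+1, j.+1) \in l].

Definition F1 := graph_of_edges 4 [:: (1,4); (2,4); (3,4)].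

Definition F2 := graph_of_edges 5
  [:: (1,2); (1,5); (2,5); (3,4); (3,5); (4,5)].

Definition F3 := graph_of_edges 6
  [:: (1,2); (1,6); (2,3); (2,5); (2,6); (3,5); (3,6); (3,4); (4,5); (5,6)].

Definition F4 := graph_of_edges 6
  [:: (1,2); (2,3); (3,4); (2,5); (3,5); (5,6)].

Definition F5 := graph_of_edges 6
  [:: (2,4); (2,5); (4,5); (1,2); (1,4); (2,3); (3,5); (4,6); (5,6)].

Definition F6 := graph_of_edges 6
  [:: (1,2); (2,3); (3,4); (4,5); (2,6); (3,6); (4,6)].

Definition F7 := graph_of_edges 7
  [:: (1,2); (2,3); (3,4); (4,5); (5,6); (2,7); (3,7); (4,7); (5,7)].

Definition F8 := graph_of_edges 7
  [:: (1,2); (1,5); (2,5); (2,6); (5,6); (2,3); (3,6); (3,7); (6,7); (3,4);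
      (4,7)].

Definition F9 := graph_of_edges 7
  [:: (1,2); (1,4); (2,3); (2,4); (2,5); (2,7); (3,6); (3,5); (3,7); (4,5);
      (4,7); (5,6); (5,7)].

(* Main.v *)
Require Import Defs.
From mathcomp Require Import all_boot zify.

Set Implicit Arguments.
Unset Strict Implicit.
Unset Printing Implicit Defensive.

(** The Gallai graph of an induced subgraph is an induced subgraph of the Gallai
    graph, so for one direction it suffices to exhibit a cycle in the Gallai
    graph of each forbidden graph.

    Conversely, the Gallai graph is the union over v of the complements H_v of
    G[N(v)], where the vertex u of H_v is identified with the vertex v of H_u.
    Excluding C4, C5, F1 and F2 forces H_v to be a double star plus isolated
    vertices, hence a forest. Let G* be the graph of the edges uv such that u and
    v are both non-isolated in H_v and H_u, i.e. of the middle edges of induced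
    paths P4. The edges of a cycle of the Gallai graph cut out of each relevant
    H_v a forest with at least two leaves, and each leaf is an edge of G*: so G*
    has a subgraph of minimum degree 2, hence a cycle.
    Take a shortest cycle of G*. A triangle yields F4, F5 or F8. Otherwise
    chordality gives a chord xy in G; it is not in G*, so N[x] and N[y] are
    comparable, and the domination propagates along the cycle: one vertex h
    dominates all the cycle vertices other than its two neighbours on it. Length 4
    then gives F3 or F6, length 5 gives F7 or F9, and from length 6 on F9 or a
    chord in G*. *)

(** * Induced patterns as relations on initial segments of the naturals *)

Definition nat_adj (e : rel nat) : rel nat :=
  [rel i j | (i != j) && (e i j || e j i)].

Definition nat_embedding (G : sgraph) (e : rel nat) n (g : nat -> G) :=
  {in gtn n &, injective g} /\
  {in gtn n &, forall i j, adj (g i) (g j) = nat_adj e i j}.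

(** Both [cycle_graph n] and [graph_of_edges n l] are convertible to instances of this graph, so one
    development serves all patterns. With labels in [nat], adjacency in a concrete pattern is
    decided by computation. *)
Definition ord_graph (e : rel nat) n : sgraph :=
  graph_of_rel [rel i j : 'I_n | e i j].

Lemma embedding_of_induced (G : sgraph) (e : rel nat) n :
  0 < n -> contains_induced G (ord_graph e n) ->
  exists g : nat -> G, nat_embedding e n g.
Proof.
case: n => // n _ [S [f [[f' fK f'K] fP]]].
exists (fun i => val (f' (inord i))); split=> i j.
  rewrite !inE => ilt jlt /val_inj/(can_inj f'K)/(congr1 val) /=.
  by rewrite !inordK.
rewrite !inE => ilt jlt.
have -> : adj (val (f' (inord i))) (val (f' (inord j)))
  = adj (f' (inord i)) (f' (inord j)) by [].
by rewrite -fP !f'K /= /sym_rel /= -(inj_eq val_inj) /= !inordK.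
Qed.

Lemma induced_of_embedding (G : sgraph) (e : rel nat) n (g : nat -> G) :
  nat_embedding e n g -> contains_induced G (ord_graph e n).
Proof.
move=> [ginj gadj]; pose S := [set g i | i : 'I_n].
have gS (i : 'I_n) : g i \in S by apply: imset_f.
pose h (i : 'I_n) : {x : G | x \in S} := Sub (g i) (gS i).
have hinj : injective h.
  move=> i j /(congr1 val) /= gij; apply/val_inj/ginj => //; rewrite inE; exact: ltn_ord.
have [h' hK h'K] : bijective h.
  apply: inj_card_bij => //; rewrite card_sig card_ord -[X in _ <= X]card_ord.
  exact: leq_imset_card.
exists S; exists h'; split; first by exists h.
move=> x y; rewrite -{2}(h'K x) -{2}(h'K y).
have -> : @adj (induced S) (h (h' x)) (h (h' y)) = adj (g (h' x)) (g (h' y)) by [].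
by rewrite gadj ?inE ?ltn_ord.
Qed.

Lemma set2_eqP (T : finType) (a b c d : T) :
  [set a; b] = [set c; d] -> (a = c /\ b = d) \/ (a = d /\ b = c).
Proof.
move=> E.
have := set21 a b; have := set22 a b; have := set21 c d; have := set22 c d.
rewrite {1 2}E -{1 2}E !inE.
by do 4 (case/orP=> /eqP ?); subst; auto.
Qed.

Lemma succn_modn n i : i < n ->
  (i.+1 = n /\ i.+1 %% n = 0) \/ (i.+1 < n /\ i.+1 %% n = i.+1).
Proof.
by rewrite leq_eqVlt => /orP[/eqP <-|lt]; [left|right]; rewrite ?modnn ?modn_small.
Qed.

Lemma cycle_nthP (T : Type) (x0 : T) (r : rel T) s :
  reflect (forall i, i < size s -> r (nth x0 s i) (nth x0 s (i.+1 %% size s)))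
          (cycle r s).
Proof.
case: s => [|x s]; first by constructor.
apply: (iffP (pathP x0)); rewrite size_rcons => H i /= ilt.
  have := H i ilt; rewrite -rcons_cons !nth_rcons /= ilt.
  case: (ltngtP i (size s)) ilt => [lt _|gt ilt|-> _]; [|lia|].
    by rewrite modn_small.
  by rewrite modnn.
have := H i ilt; rewrite -rcons_cons !nth_rcons /= ilt.
case: (ltngtP i (size s)) ilt => [lt _|gt ilt|-> _]; [|lia|].
  by rewrite modn_small.
by rewrite modnn.
Qed.

(** * Cycles in the Gallai graphs of the forbidden subgraphs *)

Definition nat_gallai_adj (e : rel nat) (p q : nat * nat) :=
  [|| [&& p.1 == q.1, p.2 != q.2 & ~~ nat_adj e p.2 q.2],
      [&& p.1 == q.2, p.2 != q.1 & ~~ nat_adj e p.2 q.1],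
      [&& p.2 == q.1, p.1 != q.2 & ~~ nat_adj e p.1 q.2]
    | [&& p.2 == q.2, p.1 != q.1 & ~~ nat_adj e p.1 q.1]].

(** An edge is coded by an ordered pair. Barring the reversed pair from [s] makes distinct pairs
    code distinct edges, so the coded cycle keeps its length in the Gallai graph. *)
Lemma gallai_cycle_of_embedding (G : sgraph) (e : rel nat) n (g : nat -> G)
    (s : seq (nat * nat)) :
  nat_embedding e n g -> 2 < size s -> uniq s ->
  all (fun p => [&& p.1 < n, p.2 < n, nat_adj e p.1 p.2 &
                    (p.2, p.1) \notin s]) s ->
  cycle (nat_gallai_adj e) s -> ~ forest (gallai G).
Proof.
move=> [ginj gadj] szs us /allP sP cs forG.
pose E (p : nat * nat) : {set G} := [set g p.1; g p.2].
have Eedge p : p \in s -> E p \in edges G.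
  move=> /sP /and4P[p1 p2 p12 _]; apply/imset2P; exists (g p.1) (g p.2) => //.
  by rewrite inE gadj.
have [p0 p0s] : exists p0, p0 \in s.
  by case: s szs {us sP cs Eedge} => // p s _; exists p; rewrite inE eqxx.
pose e0 : {x | x \in edges G} := Sub (E p0) (Eedge _ p0s).
pose F p : gallai G := insubd e0 (E p).
have FE p : p \in s -> val (F p) = E p.
  by move=> ps; rewrite val_insubd Eedge.
have Einj : {in s &, injective E}.
  move=> [a b] [c d] ps qs.
  have /and4P[/= a1 b1 ab Nba] := sP _ ps; have /and4P[/= c1 d1 cd _] := sP _ qs.
  rewrite /E /= => /set2_eqP[[H1 H2]|[H1 H2]].
    by rewrite (ginj _ _ a1 c1 H1) (ginj _ _ b1 d1 H2).
  by case/negP: Nba; rewrite (ginj _ _ a1 d1 H1) (ginj _ _ b1 c1 H2).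
apply: (forG (map F s)); rewrite ?size_map //.
  rewrite map_inj_in_uniq // => p q ps qs /(congr1 val).
  by rewrite !FE //; apply: Einj.
rewrite cycle_map; apply: (sub_in_cycle (P := mem s)) (cs); last by apply/allP.
move=> p q ps qs pq /=; apply/andP; split.
  apply/negP => /eqP/(congr1 val); rewrite !FE // => /(Einj _ _ ps qs) eqpq.
  have /and4P[_ _ /andP[/negPf q12 _] _] := sP _ qs.
  by move: pq; rewrite eqpq /nat_gallai_adj [q.2 == q.1]eq_sym q12 !eqxx.
have /and4P[p1 p2 p12 _] := sP _ ps; have /and4P[q1 q2 q12 _] := sP _ qs.
have W u v w : u < n -> v < n -> w < n -> E p = [set g u; g v] -> E q = [set g v; g w] ->
    u != w -> ~~ nat_adj e u w ->
    [exists u, exists v, exists w,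
     [&& val (F p) == [set u; v], val (F q) == [set v; w], u != w & ~~ adj u w]].
  move=> un vn wn Ep Eq uw auw; apply/existsP; exists (g u); apply/existsP; exists (g v).
  apply/existsP; exists (g w); rewrite !FE // Ep Eq !eqxx gadj // auw andbT /=.
  by apply: contra uw => /eqP/ginj-> .
case/or4P: pq => /and3P[/eqP eqv neq nadj].
- by apply: (W p.2 p.1 q.2); rewrite // /E ?eqv // setUC.
- by apply: (W p.2 p.1 q.1); rewrite // /E ?eqv // setUC.
- by apply: (W p.1 p.2 q.2); rewrite // /E ?eqv.
- by apply: (W p.1 p.2 q.1); rewrite // /E ?eqv // setUC.
Qed.

(** Consecutive edges of an induced cycle of length at least 4 span no triangle, so its edges form a
    cycle of the Gallai graph. *)
Lemma forest_gallai_chordal (G : sgraph) : forest (gallai G) -> chordal G.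
Proof.
move=> forG n n4 /(embedding_of_induced (e := fun i j => j == i.+1 %% n)).
have n0 : 0 < n by lia.
case/(_ n0)=> g gP; pose s := [seq (i, i.+1 %% n) | i <- iota 0 n].
have modS := @succn_modn n.
apply: (gallai_cycle_of_embedding (s := s) gP) forG.
- by rewrite size_map size_iota; lia.
- by rewrite map_inj_uniq ?iota_uniq // => i j [].
- apply/allP => p /mapP[i]; rewrite mem_iota add0n /= => ilt -> /=.
  rewrite ilt ltn_mod n0 /=; apply/andP; split.
    by rewrite /nat_adj /= eqxx andbT; case: (modS i ilt) => -[? ->]; lia.
  apply/mapP => -[j]; rewrite mem_iota add0n /= => jlt [ij ji].
  by case: (modS i ilt) ij => -[? ->]; case: (modS j jlt) ji => -[? ->]; lia.
- rewrite cycle_map; apply/(cycle_nthP 0) => i; rewrite size_iota => ilt.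
  rewrite !nth_iota ?ltn_mod // !add0n /nat_gallai_adj /nat_adj /= eqxx /=.
  apply/or4P/Or43; case: (modS i ilt) => -[? ->].
    by rewrite !modn_small; lia.
  case: (modS i.+1) => [|[? ->]|[? ->]]; first by [].
    by rewrite modn_small; lia.
  by case: (modS i.+2) => [|[? ->]|[? ->]]; lia.
Qed.

Lemma forest_gallai_free (G : sgraph) n l (s : seq (nat * nat)) :
  let e := [rel i j | (i.+1, j.+1) \in l] in
  [&& 0 < n, 2 < size s, uniq s,
      all (fun p => [&& p.1 < n, p.2 < n, nat_adj e p.1 p.2 &
                        (p.2, p.1) \notin s]) s
    & cycle (nat_gallai_adj e) s] ->
  forest (gallai G) -> ~ contains_induced G (graph_of_edges n l).
Proof.
move=> e /and5P[n0 szs us sP cs] forG /(embedding_of_induced (e := e) n0)[g gP].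
exact: gallai_cycle_of_embedding gP szs us sP cs forG.
Qed.

(** Each list is an explicit cycle in the Gallai graph of the pattern, with label k written as k -
    1; its validity is checked by computation. *)
Lemma forest_gallai_F_free (G : sgraph) : forest (gallai G) ->
  ~ contains_induced G F1 /\ ~ contains_induced G F2 /\
  ~ contains_induced G F3 /\ ~ contains_induced G F4 /\
  ~ contains_induced G F5 /\ ~ contains_induced G F6 /\
  ~ contains_induced G F7 /\ ~ contains_induced G F8 /\
  ~ contains_induced G F9.
Proof.
move=> forG; do ![split].
- by apply: (@forest_gallai_free G _ _ [:: (0, 3); (1, 3); (2, 3)]) forG.
- by apply: (@forest_gallai_free G _ _ [:: (0, 4); (2, 4); (1, 4); (3, 4)]) forG.
- by apply: (@forest_gallai_free G _ _ [:: (0, 1); (1, 2); (2, 3); (2, 5);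
    (0, 5); (4, 5); (3, 4); (1, 4)]) forG.
- by apply: (@forest_gallai_free G _ _ [:: (0, 1); (1, 2); (2, 3); (2, 4);
    (4, 5); (1, 4)]) forG.
- by apply: (@forest_gallai_free G _ _ [:: (1, 3); (1, 2); (0, 1); (1, 4);
    (4, 5); (2, 4); (3, 4); (0, 3); (3, 5)]) forG.
- by apply: (@forest_gallai_free G _ _ [:: (0, 1); (1, 2); (2, 3); (3, 4);
    (3, 5); (1, 5)]) forG.
- by apply: (@forest_gallai_free G _ _ [:: (0, 1); (1, 2); (2, 3); (3, 4);
    (4, 5); (4, 6); (1, 6)]) forG.
- by apply: (@forest_gallai_free G _ _ [:: (0, 1); (1, 5); (5, 6); (4, 5);
    (2, 5); (2, 3); (1, 2)]) forG.
- by apply: (@forest_gallai_free G _ _ [:: (0, 1); (1, 2); (2, 5); (2, 6);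
    (3, 6); (0, 3); (3, 4); (4, 5); (1, 4)]) forG.
Qed.

(** * Cycles from minimum degree two *)

Lemma cycle_of_min_degree2 (T : finType) (r : rel T) (W : {set T}) :
  symmetric r -> irreflexive r -> W != set0 ->
  {in W, forall v, exists x y, [/\ x \in W, y \in W, x != y & r v x && r v y]} ->
  exists s : seq T, [/\ 2 < size s, uniq s & cycle r s].
Proof.
move=> rC rirr /set0Pn[v0 v0W] deg2.
(* Extend a path at its end [x], where [head x p] is the vertex visited just before [x], until the
   next vertex is already on the path. *)
suff ext n x p : path r x p -> uniq (x :: p) -> x \in W -> #|T| - size p < n ->
    exists s : seq T, [/\ 2 < size s, uniq s & cycle r s].
  by apply: (ext #|T|.+1 v0 [::]); rewrite //= subn0.
elim: n x p => // n IH x p xp up xW szp.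
have [y [yW rxy hy]] : exists y, [/\ y \in W, r x y & y != head x p].
  have [y [z [yW zW yz /andP[xy xz]]]] := deg2 x xW.
  have [yp|yp] := eqVneq y (head x p); last by exists y.
  by exists z; split; rewrite // -yp eq_sym.
have [yp|yp] := boolP (y \in p); last first.
  have uyp : uniq (y :: x :: p).
    rewrite cons_uniq up andbT inE negb_or yp andbT; apply: contraTneq rxy => ->.
    by rewrite rirr.
  apply: (IH y (x :: p)) => //=; first by rewrite rC rxy.
  have := max_card (mem (y :: x :: p)); rewrite (card_uniqP uyp) /=.
  by move: szp; move: #|T| (size p) => c d; clear; lia.
case: (splitPr yp) xp up hy => -[|z p1] p2; first by rewrite /= eqxx.
rewrite -[y :: p2]cat1s catA cat_path -cat_cons cat_uniq => /andP[xp _] /andP[up _] _.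
exists (x :: (z :: p1) ++ [:: y]); split=> //; first by rewrite /= size_cat /= addn1.
by rewrite /cycle rcons_path xp last_cat /= rC.
Qed.

(** * Local structure of graphs without the forbidden subgraphs *)

(** Only the part of the adjacency matrix below the diagonal is listed, which leaves one equation
    per unordered pair. *)
Definition adj_table (G : sgraph) (x0 : G) (vs : seq G) :=
  [seq [seq adj (nth x0 vs i) (nth x0 vs j) | j <- iota 0 i]
     | i <- iota 0 (size vs)].

Definition nat_adj_table (e : rel nat) n :=
  [seq [seq nat_adj e i j | j <- iota 0 i] | i <- iota 0 n].

Lemma nat_adjC e : symmetric (nat_adj e).
Proof. by move=> i j; rewrite /nat_adj /= eq_sym orbC. Qed.

Lemma adj_tableP (G : sgraph) (x0 : G) vs e :
  adj_table x0 vs = nat_adj_table e (size vs) ->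
  {in gtn (size vs) &, forall i j,
    adj (nth x0 vs i) (nth x0 vs j) = nat_adj e i j}.
Proof.
move=> /eq_in_map tab.
have lt i j : j < i -> i < size vs -> adj (nth x0 vs i) (nth x0 vs j) = nat_adj e i j.
  move=> ji ilt; have := tab i; rewrite mem_iota /= => /(_ ilt)/eq_in_map; apply.
  by rewrite mem_iota.
move=> i j; rewrite !inE => ilt jlt; case: (ltngtP i j) => [ij|ji|->].
- by rewrite adj_sym nat_adjC lt.
- exact: lt.
- by rewrite adj_irrefl /nat_adj /= eqxx.
Qed.

(** Meant for C4 and the claw, whose nonadjacent twins are not told apart by adjacencies. *)
Lemma contains_of_uniq_table (G : sgraph) (x0 : G) vs e :
  uniq vs -> adj_table x0 vs = nat_adj_table e (size vs) ->
  contains_induced G (ord_graph e (size vs)).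
Proof.
move=> us /adj_tableP tab; apply: (induced_of_embedding (g := nth x0 vs)).
by split=> // i j ilt jlt /eqP; rewrite nth_uniq // => /eqP.
Qed.

(* When no two nonadjacent vertices of the pattern have the same neighbours,
   the adjacencies alone force the listed vertices to be distinct. *)
Lemma contains_of_table (G : sgraph) (x0 : G) vs e :
  let n := size vs in
  all (fun i => all (fun j => [|| i == j, nat_adj e i j
        | has (fun k => nat_adj e i k != nat_adj e j k) (iota 0 n)])
      (iota 0 n)) (iota 0 n) ->
  adj_table x0 vs = nat_adj_table e n ->
  contains_induced G (ord_graph e n).
Proof.
move=> n /allP twin /adj_tableP tab; apply: (induced_of_embedding (g := nth x0 vs)).
split=> // i j ilt jlt eqij; have := twin i; rewrite mem_iota => /(_ ilt)/allP/(_ j).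
rewrite mem_iota => /(_ jlt)/or3P[/eqP//||/hasP[k]].
  by rewrite -tab // eqij adj_irrefl.
by rewrite mem_iota /= => klt; rewrite -!tab // eqij eqxx.
Qed.

Lemma contains_edges_of_table (G : sgraph) (x0 : G) vs l :
  let n := size vs in
  let e := [rel i j | (i.+1, j.+1) \in l] in
  all (fun i => all (fun j => [|| i == j, nat_adj e i j
        | has (fun k => nat_adj e i k != nat_adj e j k) (iota 0 n)])
      (iota 0 n)) (iota 0 n) ->
  adj_table x0 vs = nat_adj_table e n ->
  contains_induced G (graph_of_edges n l).
Proof. exact: contains_of_table. Qed.

Section CoAdjacency.
Variable G : sgraph.
Implicit Types x y z u v w : G.

Definition coadj : rel G := [rel x y | (x != y) && ~~ adj x y].

Lemma coadjC x y : coadj x y = coadj y x.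
Proof. by rewrite /coadj /= eq_sym adj_sym. Qed.

Lemma coadjxx x : coadj x x = false.
Proof. by rewrite /coadj /= eqxx. Qed.

Lemma coadj_adjF x y : coadj x y -> adj x y = false.
Proof. by case/andP=> _ /negbTE. Qed.

Lemma adjI x y : (x = y -> False) -> (coadj x y -> False) -> adj x y.
Proof.
move=> neq nco; apply/negPn/negP => nadj; apply: nco; apply/andP; split=> //.
by apply/eqP => /neq.
Qed.

Lemma coadjI x y : (x = y -> False) -> (adj x y -> False) -> coadj x y.
Proof. by move=> neq nadj; apply/andP; split; [apply/eqP=> /neq|apply/negP]. Qed.

End CoAdjacency.

Ltac absurd_adj := match goal with
  | H : is_true (adj ?x ?x) |- _ => by rewrite adj_irrefl in H
  | H : is_true (coadj ?x ?x) |- _ => by rewrite coadjxx in H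
  | H : is_true (adj ?x ?y), H' : is_true (coadj ?x ?y) |- _ =>
      by rewrite (coadj_adjF H') in H
  | H : is_true (adj ?x ?y), H' : is_true (coadj ?y ?x) |- _ =>
      by rewrite adj_sym (coadj_adjF H') in H
  end.

Ltac adj_auto := match goal with
  | |- is_true (adj _ _) => first [assumption | rewrite adj_sym; assumption]
  | |- is_true (coadj _ _) => first [assumption | rewrite coadjC; assumption]
  | |- adj _ _ = true => first [assumption | rewrite adj_sym; assumption]
  | |- adj _ _ = false =>
     apply: coadj_adjF; first [assumption | rewrite coadjC; assumption]
  end.

Ltac neq_auto := move=> ?; subst; absurd_adj.

Ltac table_auto :=
  cbv -[adj];
  repeat match goal with
  | |- [::] = [::] => reflexivity
  | |- cons _ _ = cons _ _ => apply: (f_equal2 cons)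
  | _ => adj_auto
  end.

Ltac pattern_auto := first [by [] | table_auto].

Section ForbiddenPatterns.
Variable G : sgraph.
Hypothesis chG : chordal G.
Implicit Types a b c d h u v w x y z : G.

Lemma chordal_C4 a b c d :
  adj a b -> adj b c -> adj c d -> adj d a -> coadj a c -> coadj b d -> False.
Proof.
move=> ab bc cd da ac bd; apply: (chG (n := 4)) => //.
apply: (@contains_of_uniq_table _ a [:: a; b; c; d] (fun i j => j == i.+1 %% 4)).
  rewrite /= !inE !negb_or; case/andP: ac => -> _; case/andP: bd => -> _.
  by rewrite !andbT; apply/and3P; split; [apply/andP; split|..]; apply/eqP; neq_auto.
table_auto.
Qed.

Lemma chordal_C5 a b c d u :
  adj a b -> adj b c -> adj c d -> adj d u -> adj u a ->
  coadj a c -> coadj b d -> coadj c u -> coadj d a -> coadj u b -> False.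
Proof.
move=> *; apply: (chG (n := 5)) => //.
by apply: (@contains_of_table _ a [:: a; b; c; d; u] (fun i j => j == i.+1 %% 5));
  pattern_auto.
Qed.

Hypothesis noF1 : ~ contains_induced G F1.

Lemma claw_free v a b c : adj v a -> adj v b -> adj v c ->
  coadj a b -> coadj b c -> coadj a c -> False.
Proof.
move=> va vb vc ab bc ac; apply: noF1.
apply: (@contains_of_uniq_table _ a [:: a; b; c; v]
  [rel i j | (i.+1, j.+1) \in [:: (1,4); (2,4); (3,4)]]).
  rewrite /= !inE !negb_or; case/andP: ab => -> _; case/andP: ac => -> _.
  case/andP: bc => -> _.
  by rewrite /= andbT; do ![apply/andP; split]; apply/eqP; neq_auto.
table_auto.
Qed.

Hypothesis noF2 : ~ contains_induced G F2.

Lemma bowtie_free v a b c d :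
  adj v a -> adj v b -> adj v c -> adj v d -> adj a b -> adj c d ->
  coadj a c -> coadj a d -> coadj b c -> coadj b d -> False.
Proof.
move=> *; apply: noF2.
by apply: (@contains_edges_of_table _ v [:: a; b; c; d; v]); pattern_auto.
Qed.

(* In the complement of G[N(v)], every path x' - x - y - y' has x' as a leaf. *)
Lemma coadj_path_leaf v x' x y y' z :
  adj v x' -> adj v x -> adj v y -> adj v y' -> adj v z ->
  coadj x' x -> coadj x y -> coadj y y' -> x' <> y -> x <> y' ->
  coadj z x' -> z = x.
Proof.
(* For a second neighbour z of x' in the complement, claws, bowties and a C5 successively force
   every pair not known to be nonadjacent to be an edge of G, until z y x' y' is an induced C4. *)
move=> vx' vx vy vy' vz x'x xy yy' x'y xy' zx'; case: (eqVneq z x) => // /eqP zx; exfalso.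
have {x'y} x'y : adj x' y.
  by apply: adjI => // ?; apply: (claw_free vx' vx vy); adj_auto.
have {xy'} xy' : adj x y'.
  by apply: adjI => // ?; apply: (claw_free vx vy vy'); adj_auto.
have x'y' : adj x' y'.
  apply: adjI => [|?]; first by neq_auto.
  by apply: (@bowtie_free v x' y x y'); adj_auto.
have {}zx : adj z x.
  by apply: adjI => // ?; apply: (claw_free vz vx' vx); adj_auto.
have zy : adj z y.
  apply: adjI => [|?]; first by neq_auto.
  by apply: (@bowtie_free v z x x' y); adj_auto.
have zy' : adj z y'.
  apply: adjI => [|?]; first by neq_auto.
  by apply: (@chordal_C5 z x y' x' y); adj_auto.
by apply: (@chordal_C4 z y x' y'); adj_auto.
Qed.

(** This is the double star with centres a and b. An end of xy attached to a or b would be a leaf by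
    [coadj_path_leaf], yet it has the other end as a neighbour. So in G both ends are adjacent to a
    and b, and x a y b is an induced C4. *)
Lemma coadj_edge_meets v p a b q x y :
  adj v p -> adj v a -> adj v b -> adj v q -> adj v x -> adj v y ->
  coadj p a -> coadj a b -> coadj b q -> p <> b -> a <> q ->
  coadj x y -> [\/ x = a, x = b, y = a | y = b].
Proof.
move=> vp va vb vq vx vy pa ab bq pb aq xy.
have qb : coadj q b by adj_auto.
have ba : coadj b a by adj_auto.
have ap : coadj a p by adj_auto.
have yx : coadj y x by adj_auto.
have leaf (t u : G) : adj v t -> adj v u -> coadj t u -> t <> a -> t <> b ->
    u <> a -> u <> b -> adj t a /\ adj t b.
  move=> vt vu tu ta tb ua ub; have ut : coadj u t by adj_auto.
  split; apply: adjI => // c.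
    by apply: ua; apply: (@coadj_path_leaf v t a b q u).
  by apply: ub; apply: (@coadj_path_leaf v t b a p u) => // /esym.
case: (eqVneq x a) => [|/eqP xa]; first by constructor 1.
case: (eqVneq x b) => [|/eqP xb]; first by constructor 2.
case: (eqVneq y a) => [|/eqP ya]; first by constructor 3.
case: (eqVneq y b) => [|/eqP yb]; first by constructor 4.
have [xa' xb'] := leaf x y vx vy xy xa xb ya yb.
have [ya' yb'] := leaf y x vy vx yx ya yb xa xb.
by exfalso; apply: (@chordal_C4 x a y b); adj_auto.
Qed.

(** * Middle edges of induced paths on four vertices *)

(* [p4mid x y]: xy is the middle edge of a path z - x - y - z' with neither
   z y nor z' x an edge; in a chordal graph that path is an induced P4. *)
Definition p4mid : rel G := [rel x y |
  [&& adj x y, [exists z, adj x z && coadj z y] & [exists z, adj y z && coadj z x]]].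

(** For adjacent x and y this is the inclusion of closed neighbourhoods of x in y. *)
Definition dominated : rel G := [rel x y | [forall z, adj x z ==> ~~ coadj z y]].

Lemma p4midP x y : reflect
  [/\ adj x y, exists2 z, adj x z & coadj z y & exists2 z, adj y z & coadj z x]
  (p4mid x y).
Proof.
apply: (iffP and3P) => -[xy /exists_inP ? /exists_inP ?]; split=> //; exact/exists_inP.
Qed.

Lemma p4midC x y : p4mid x y = p4mid y x.
Proof. by rewrite /p4mid /= adj_sym; congr (_ && _); rewrite andbC. Qed.

Lemma p4mid_adj x y : p4mid x y -> adj x y.
Proof. by case/and3P. Qed.

Lemma p4mid_irrefl : irreflexive p4mid.
Proof. by move=> x; rewrite /p4mid /= adj_irrefl. Qed.

Lemma dominated_adj x y z : dominated x y -> adj x z -> z <> y -> adj z y.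
Proof.
move=> /forall_inP dxy xz zy; apply: adjI => // c.
by have /negP := dxy _ xz.
Qed.

Lemma dominated_coadj x y z : dominated x y -> adj x y -> coadj z y -> coadj x z.
Proof.
move=> dxy xy zy; apply: coadjI => [|xz]; first by neq_auto.
by have /forall_inP/(_ z xz) := dxy; rewrite zy.
Qed.

Lemma p4mid_not_dominated x y : p4mid x y -> dominated x y = false.
Proof.
case/p4midP=> xy [z xz zy] _; apply/negP => /forall_inP/(_ z xz).
by rewrite zy.
Qed.

Lemma dominated_of_not_p4mid x y :
  adj x y -> ~~ p4mid x y -> dominated x y \/ dominated y x.
Proof.
move=> xy; rewrite /p4mid /= xy /= negb_and => /orP[] H; [left|right];
  by apply/forall_inP => z xz; apply: contra H => c; apply/exists_inP; exists z.
Qed.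

(** Since hy is an edge of G but not of G*, N[h] and N[y] are comparable. If N[h] were inside N[y],
    then N[x] would be too, against xy being in G*. *)
Lemma dominated_step h x y : dominated x h -> adj x h -> p4mid x y ->
  ~~ p4mid h y -> y <> h -> dominated y h /\ adj y h.
Proof.
move=> dxh xh mxy nhy yh; have xy := p4mid_adj mxy.
have hy : adj y h by apply: dominated_adj dxh xy yh.
split=> //; case: (dominated_of_not_p4mid _ nhy) => //; first by adj_auto.
move=> dhy; have := p4mid_not_dominated mxy => /negP[].
apply/forall_inP => z xz; apply/negP => zy.
have zh : z <> h by neq_auto.
have := dominated_adj dxh xz zh; rewrite adj_sym => hz.
have zny : z <> y by neq_auto.
have := dominated_adj dhy hz zny => ?; absurd_adj.
Qed.

Hypothesis noF3 : ~ contains_induced G F3.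
Hypothesis noF4 : ~ contains_induced G F4.
Hypothesis noF5 : ~ contains_induced G F5.
Hypothesis noF6 : ~ contains_induced G F6.
Hypothesis noF7 : ~ contains_induced G F7.
Hypothesis noF8 : ~ contains_induced G F8.
Hypothesis noF9 : ~ contains_induced G F9.

(** * Triangles of middle edges *)

(** A corner of such a triangle has either a pendant neighbour or an ear on each of its two
    sides. *)
Lemma p4mid_corner u v w :
  p4mid u v -> p4mid u w -> adj v w ->
  (exists p, [/\ adj u p, coadj p v & coadj p w]) \/
  (exists q r, [/\ adj u q, adj w q & coadj q v] /\ [/\ adj u r, adj v r & coadj r w]).
Proof.
move=> /p4midP[uv [q uq qv] _] /p4midP[uw [r ur rw] _] vw.
case: (boolP (coadj q w)) => [qw|/negP nqw]; first by left; exists q.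
case: (boolP (coadj r v)) => [rv|/negP nrv]; first by left; exists r.
right; exists q, r; split; split=> //.
  by rewrite adj_sym; apply: adjI => //; neq_auto.
by rewrite adj_sym; apply: adjI => //; neq_auto.
Qed.

Lemma no_three_pendants u v w p q r :
  adj u v -> adj u w -> adj v w ->
  adj u p -> coadj p v -> coadj p w ->
  adj v q -> coadj q u -> coadj q w ->
  adj w r -> coadj r u -> coadj r v -> False.
Proof.
move=> uv uw vw up pv pw vq qu qw wr ru rv.
have pq : coadj p q.
  by apply: coadjI => [|?]; [neq_auto|apply: (@chordal_C4 p u v q); adj_auto].
have pr : coadj p r.
  by apply: coadjI => [|?]; [neq_auto|apply: (@chordal_C4 p u w r); adj_auto].
have qr : coadj q r.
  by apply: coadjI => [|?]; [neq_auto|apply: (@chordal_C4 q v w r); adj_auto].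
by apply: noF4; apply: (@contains_edges_of_table _ u [:: p; u; v; q; w; r]); pattern_auto.
Qed.

Lemma no_three_ears u v w p q r :
  adj u v -> adj u w -> adj v w ->
  adj u p -> adj v p -> coadj p w ->
  adj u q -> adj w q -> coadj q v ->
  adj v r -> adj w r -> coadj r u -> False.
Proof.
move=> uv uw vw up vp pw uq wq qv vr wr ru.
have pq : coadj p q.
  by apply: coadjI => [|?]; [neq_auto|apply: (@chordal_C4 p v w q); adj_auto].
have pr : coadj p r.
  by apply: coadjI => [|?]; [neq_auto|apply: (@chordal_C4 p u w r); adj_auto].
have qr : coadj q r.
  by apply: coadjI => [|?]; [neq_auto|apply: (@chordal_C4 q u v r); adj_auto].
by apply: noF5; apply: (@contains_edges_of_table _ u [:: p; u; q; v; w; r]); pattern_auto.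
Qed.

(** Claw-freeness at u and v joins each pendant to the ear at its corner, and the result is F8. *)
Lemma no_two_pendants_two_ears u v w p q r t :
  adj u v -> adj u w -> adj v w ->
  adj u p -> coadj p v -> coadj p w ->
  adj v q -> coadj q u -> coadj q w ->
  adj u r -> adj w r -> coadj r v ->
  adj v t -> adj w t -> coadj t u -> False.
Proof.
move=> uv uw vw up pv pw vq qu qw ur wr rv vt wt tu.
have pq : coadj p q.
  by apply: coadjI => [|?]; [neq_auto|apply: (@chordal_C4 p u v q); adj_auto].
have rt : coadj r t.
  by apply: coadjI => [|?]; [neq_auto|apply: (@chordal_C4 r u v t); adj_auto].
have pt : coadj p t.
  by apply: coadjI => [|?]; [neq_auto|apply: (@chordal_C4 p u v t); adj_auto].
have qr : coadj q r.
  by apply: coadjI => [|?]; [neq_auto|apply: (@chordal_C4 q v u r); adj_auto].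
have pr : adj p r.
  by apply: adjI => [|?]; [neq_auto|apply: (@claw_free u p r v); adj_auto].
have qt : adj q t.
  by apply: adjI => [|?]; [neq_auto|apply: (@claw_free v q t u); adj_auto].
by apply: noF8; apply: (@contains_edges_of_table _ u [:: p; u; v; q; r; w; t]);
  pattern_auto.
Qed.

(** Pendants at all three corners give F4 and at exactly two give F8. Otherwise two corners have
    ears, hence every side has one, which gives F5. *)
Lemma p4mid_triangle_free u v w : p4mid u v -> p4mid v w -> p4mid u w -> False.
Proof.
move=> muv mvw muw; have uv := p4mid_adj muv; have vw := p4mid_adj mvw.
have uw := p4mid_adj muw; have mvu : p4mid v u by rewrite p4midC.
have mwu : p4mid w u by rewrite p4midC.
have mwv : p4mid w v by rewrite p4midC.
have vu : adj v u by adj_auto. have wv : adj w v by adj_auto.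
have wu : adj w u by adj_auto.
have [[p [p1 p2 p3]]|[p [p' [[p1 p2 p3] [p4 p5 p6]]]]] := p4mid_corner muv muw vw;
have [[q [q1 q2 q3]]|[q [q' [[q1 q2 q3] [q4 q5 q6]]]]] := p4mid_corner mvu mvw uw;
have [[r [r1 r2 r3]]|[r [r' [[r1 r2 r3] [r4 r5 r6]]]]] := p4mid_corner mwu mwv uv.
- exact: (no_three_pendants uv uw vw p1 p2 p3 q1 q2 q3 r1 r2 r3).
- exact: (@no_two_pendants_two_ears u v w p q r' r).
- exact: (@no_two_pendants_two_ears u w v p r q' q).
- exact: (@no_three_ears u v w q' r' q).
- exact: (@no_two_pendants_two_ears v w u q r p' p).
- exact: (@no_three_ears u v w p' p r).
- exact: (@no_three_ears u v w p' p q).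
- exact: (@no_three_ears u v w p' p q).
Qed.

(** * Cycles of middle edges around a dominating vertex *)

(** With both diagonals the square is a K4. Domination joins q to p3 and x to h, which completes
    F3. *)
Lemma no_dominated_square h p1 p2 p3 :
  adj h p1 -> adj p1 p2 -> adj p2 p3 -> adj p3 h -> adj p2 h -> dominated p2 h ->
  adj p1 p3 -> dominated p1 p3 ->
  (exists2 q, adj p1 q & coadj q h) -> (exists2 x, adj p2 x & coadj x p3) -> False.
Proof.
move=> hp1 p12 p23 p3h p2h d2 p13 d1 [q p1q qh] [x p2x xp3].
have p2q := dominated_coadj d2 p2h qh.
have p1x := dominated_coadj d1 p13 xp3.
have qp3 : adj q p3 by apply: dominated_adj d1 p1q _; neq_auto.
have xh : adj x h by apply: dominated_adj d2 p2x _; neq_auto.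
have qx : coadj q x.
  by apply: coadjI => [|?]; [neq_auto|apply: (@chordal_C4 x h p1 q); adj_auto].
by apply: noF3; apply: (@contains_edges_of_table _ h [:: x; p2; p1; q; p3; h]);
  pattern_auto.
Qed.

Lemma p4mid_square_free h p1 p2 p3 :
  p4mid h p1 -> p4mid p1 p2 -> p4mid p2 p3 -> p4mid p3 h ->
  adj p2 h -> dominated p2 h -> p1 <> p3 -> ~~ p4mid p1 p3 -> False.
Proof.
move=> /p4midP[hp1 _ [q1 p1q1 q1h]] /p4midP[p12 _ [x1 p2x1 x1p1]].
move=> /p4midP[p23 [x3 p2x3 x3p3] _] /p4midP[p3h [q3 p3q3 q3h] _] p2h d2 p1Np3 nm.
case: (boolP (coadj p1 p3)) => [p13|/negP Np13]; last first.
  have p13 : adj p1 p3 by apply: adjI.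
  case: (dominated_of_not_p4mid p13 nm) => d.
    by apply: (@no_dominated_square h p1 p2 p3) => //; [exists q1|exists x3].
  by apply: (@no_dominated_square h p3 p2 p1) => //;
    [adj_auto..|exists q3|exists x1].
(* Without the diagonal p1p3, the path q1 p1 p2 p3 q3 and h form F6. *)
have p2q1 := dominated_coadj d2 p2h q1h; have p2q3 := dominated_coadj d2 p2h q3h.
have q1p3 : coadj q1 p3.
  by apply: coadjI => [|?]; [neq_auto|apply: (@chordal_C4 q1 p1 h p3); adj_auto].
have q3p1 : coadj q3 p1.
  by apply: coadjI => [|?]; [neq_auto|apply: (@chordal_C4 q3 p3 h p1); adj_auto].
have q13 : coadj q1 q3.
  by apply: coadjI => [|?]; [neq_auto|apply: (@chordal_C5 q1 p1 h p3 q3); adj_auto].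
by apply: noF6; apply: (@contains_edges_of_table _ h [:: q1; p1; p2; p3; q3; h]);
  pattern_auto.
Qed.

(** In the complement of G[N(h)], p2 - a - b - p3 is a path and p1 x an edge, where x witnesses that
    p1p2 is in G*. By [coadj_edge_meets] this edge meets a or b; apart from p1 = b only x = b is
    consistent, and it leads to F9. *)
Lemma dominated_pair_end h p1 p2 p3 a b :
  adj p2 h -> adj p3 h -> dominated p2 h -> dominated p3 h -> adj p2 p3 ->
  adj p3 a -> coadj a p2 -> adj p2 b -> coadj b p3 ->
  p4mid h p1 -> p4mid p1 p2 -> p1 <> p3 -> p1 = b.
Proof.
move=> p2h p3h d2 d3 p23 p3a ap2 p2b bp3.
move=> /p4midP[hp1 _ [q p1q qh]] /p4midP[p12 _ [x p2x xp1]] p1Np3.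
have ah : adj a h by apply: dominated_adj d3 p3a _; neq_auto.
have bh : adj b h by apply: dominated_adj d2 p2b _; neq_auto.
have xh : adj x h by apply: dominated_adj d2 p2x _; neq_auto.
have ab : coadj a b.
  by apply: coadjI => [|?]; [neq_auto|apply: (@chordal_C4 a b p2 p3); adj_auto].
have : [\/ p1 = a, p1 = b, x = a | x = b].
  by apply: (@coadj_edge_meets h p2 a b p3 p1 x); first [adj_auto | neq_auto].
case=> // E; exfalso; [by subst; absurd_adj..|subst x].
have p1a : adj p1 a.
  by apply: adjI => [|?]; [neq_auto|apply: (@claw_free h p1 a b); adj_auto].
have p13 : adj p1 p3.
  by apply: adjI => // ?; apply: (@claw_free h p1 b p3); adj_auto.
have p2q := dominated_coadj d2 p2h qh; have p3q := dominated_coadj d3 p3h qh.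
have qa : adj q a.
  by apply: adjI => [|?]; [neq_auto|apply: (@claw_free p1 q a p2); adj_auto].
have qb : coadj q b.
  by apply: coadjI => [|?]; [neq_auto|apply: (@chordal_C4 q a h b); adj_auto].
by apply: noF9; apply: (@contains_edges_of_table _ h [:: q; p1; p2; a; h; b; p3]);
  pattern_auto.
Qed.

Lemma p4mid_pentagon_free h p1 p2 p3 p4 :
  p4mid h p1 -> p4mid p1 p2 -> p4mid p2 p3 -> p4mid p3 p4 -> p4mid p4 h ->
  adj p2 h -> dominated p2 h -> adj p3 h -> dominated p3 h ->
  p1 <> p3 -> p2 <> p4 -> False.
Proof.
move=> m1 m12 /p4midP[p23 [b p2b bp3] [a p3a ap2]] m34 m4 p2h d2 p3h d3 p1Np3 p2Np4.
(* The witnesses that p2p3 is in G* are the cycle vertices p1 and p4 themselves; neighbours of these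
   outside N[h] then complete F7. *)
have E1 : p1 = b by apply: (@dominated_pair_end h p1 p2 p3 a b).
have E4 : p4 = a.
  apply: (@dominated_pair_end h p4 p3 p2 b a); rewrite // 1?p4midC //; first by adj_auto.
  by move=> E; apply: p2Np4.
subst p1 p4.
case/p4midP: m1 => hb _ [b' bb' b'h]; case/p4midP: m4 => ah [a' aa' a'h] _.
have ab : coadj a b.
  by apply: coadjI => [|?]; [neq_auto|apply: (@chordal_C4 a b p2 p3); adj_auto].
have := (dominated_coadj d2 p2h a'h, dominated_coadj d3 p3h a'h).
have := (dominated_coadj d2 p2h b'h, dominated_coadj d3 p3h b'h).
move=> [p2b' p3b'] [p2a' p3a'].
have a'b : coadj a' b.
  by apply: coadjI => [|?]; [neq_auto|apply: (@chordal_C4 a' a h b); adj_auto].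
have b'a : coadj b' a.
  by apply: coadjI => [|?]; [neq_auto|apply: (@chordal_C4 b' b h a); adj_auto].
have a'b' : coadj a' b'.
  by apply: coadjI => [|?]; [neq_auto|apply: (@chordal_C5 a' a h b b'); adj_auto].
by apply: noF7; apply: (@contains_edges_of_table _ h [:: a'; a; p3; p2; b; b'; h]);
  pattern_auto.
Qed.

(** As before p1 = b. The neighbour c of p4 missed by p3 lies in N(h), and in the complement there
    p3 is a leaf attached to b, so c = p1. *)
Lemma p4mid_chord h p1 p2 p3 p4 :
  p4mid h p1 -> p4mid p1 p2 -> p4mid p2 p3 -> p4mid p3 p4 ->
  adj p2 h -> dominated p2 h -> adj p3 h -> dominated p3 h ->
  adj p4 h -> dominated p4 h -> p1 <> p3 -> p4mid p1 p4.
Proof.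
move=> m1 m12 /p4midP[p23 [b p2b bp3] [a p3a ap2]] m34 p2h d2 p3h d3 p4h d4 p1Np3.
have E1 : p1 = b by apply: (@dominated_pair_end h p1 p2 p3 a b).
subst p1; case/p4midP: m1 => hb _ [b' bb' b'h].
case/p4midP: m34 => p34 _ [c p4c cp3].
have ah : adj a h by apply: dominated_adj d3 p3a _; neq_auto.
have ch : adj c h by apply: dominated_adj d4 p4c _; neq_auto.
have ab : coadj a b.
  by apply: coadjI => [|?]; [neq_auto|apply: (@chordal_C4 a b p2 p3); adj_auto].
have E : c = b.
  by apply: (@coadj_path_leaf h p3 b a p2 c); first [adj_auto | neq_auto].
subst c; apply/p4midP; split; first by adj_auto.
- by exists b' => //; rewrite coadjC; exact: dominated_coadj d4 p4h b'h.
- by exists p3; adj_auto.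
Qed.

(* Boolean graph hypotheses would make [lia] split on irrelevant atoms. *)
Ltac arith := repeat match goal with
  | H : is_true (adj _ _) |- _ => clear H
  | H : is_true (p4mid _ _) |- _ => clear H
  | H : is_true (dominated _ _) |- _ => clear H
  | H : is_true (~~ p4mid _ _) |- _ => clear H
  | H : is_true (uniq _) |- _ => clear H
  | H : is_true (cycle _ _) |- _ => clear H
  | H : is_true (~~ [exists _, _]) |- _ => clear H
  end; lia.

(** * Shortest cycles of middle edges *)

Lemma p4mid_hub_free (x0 : G) t m :
  let n := size t in
  let p := nth x0 t in
  uniq t -> cycle p4mid t ->
  (forall i j, i < j < n -> p4mid (p i) (p j) -> j = i.+1 \/ (i = 0 /\ j.+1 = n)) ->
  1 < m -> m.+1 < n -> adj (p m) (p 0) -> dominated (p m) (p 0) -> False.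
Proof.
move=> n p ut /(cycle_nthP x0) cyc chordless m1 mn adjm domm.
have step i : i.+1 < n -> p4mid (p i) (p i.+1).
  by move=> ilt; have := cyc i (ltnW ilt); rewrite modn_small.
have last : p4mid (p n.-1) (p 0).
  by have := cyc n.-1; rewrite prednK ?modnn; [apply|]; arith.
have neq i j : i < n -> j < n -> i != j -> p i <> p j.
  by move=> ilt jlt ij /eqP; rewrite nth_uniq // (negbTE ij).
have nchord i j : i < j < n -> j <> i.+1 -> ~ (i = 0 /\ j.+1 = n) -> ~~ p4mid (p i) (p j).
  by move=> ij ji i0; apply/negP => /(chordless _ _ ij)[].
pose D k := dominated (p k) (p 0) /\ adj (p k) (p 0).
have up (d : nat) : m + d.+1 < n -> D (m + d).
  elim: d => [|d IH] ltn; first by rewrite addn0.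
  have [|dd ad] := IH; first by arith.
  rewrite addnS; apply: (@dominated_step _ (p (m + d))) => //.
  - by apply: step; arith.
  - by apply: nchord; arith.
  - by apply: neq; arith.
have down (d : nat) : d.+1 < m -> D (m - d).
  elim: d => [|d IH] ltn; first by rewrite subn0.
  have [|dd ad] := IH; first by arith.
  apply: (@dominated_step _ (p (m - d))) => //.
  - have -> : m - d = (m - d.+1).+1 by arith.
    by rewrite p4midC; apply: step; arith.
  - by apply: nchord; arith.
  - by apply: neq; arith.
(* Domination by [p 0] has spread from position [m] both ways, reaching all vertices but the two
   neighbours of [p 0] on the cycle. *)
have interior k : 1 < k -> k.+1 < n -> D k.
  move=> k1 kn; case: (leqP m k) => mk.
    by rewrite -(subnKC mk); apply: up; arith.
  by rewrite -(subKn (ltnW mk)); apply: down; arith.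
have [d2 a2] : D 2 by apply: interior; arith.
have m01 : p4mid (p 0) (p 1) by apply: step; arith.
have m12 : p4mid (p 1) (p 2) by apply: step; arith.
have m23 : p4mid (p 2) (p 3) by apply: step; arith.
have n13 : p 1 <> p 3 by apply: neq; arith.
have [n4|n4] := eqVneq n 4.
  apply: (@p4mid_square_free (p 0) (p 1) (p 2) (p 3)) => //.
    by move: last; rewrite n4.
  by apply: nchord; arith.
have [d3 a3] : D 3 by apply: interior; arith.
have m34 : p4mid (p 3) (p 4) by apply: step; arith.
have [n5|n5] := eqVneq n 5.
  apply: (@p4mid_pentagon_free (p 0) (p 1) (p 2) (p 3) (p 4)) => //.
    by move: last; rewrite n5.
  by apply: neq; arith.
have [d4 a4] : D 4 by apply: interior; arith.
have := @p4mid_chord (p 0) (p 1) (p 2) (p 3) (p 4).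
by move=> /(_ m01 m12 m23 m34 a2 d2 a3 d3 a4 d4 n13)/chordless; arith.
Qed.

Lemma p4mid_acyclic s : 2 < size s -> uniq s -> ~ cycle p4mid s.
Proof.
have [n] := ubnP (size s); elim: n s => // n IH s sn s3 us cs.
have [x0 _] : exists x0, x0 \in s.
  by case: s s3 {sn us cs} => // x s; exists x; rewrite mem_head.
have chordless t : size t = size s -> uniq t -> cycle p4mid t ->
    forall i j, i < j < size t -> p4mid (nth x0 t i) (nth x0 t j) ->
    j = i.+1 \/ (i = 0 /\ j.+1 = size t).
  move=> szt ut /(cycle_nthP x0) ct i j /andP[ij jt] mij.
  have [->|ji] := eqVneq j i.+1; first by left.
  have [i0|i0] := boolP ((i == 0) && (j.+1 == size t)).
    by right; split; arith.
  (* The segment from i to j, closed by the chord, is a shorter cycle. *)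
  exfalso; pose u := drop i (take j.+1 t).
  have szu : size u = j.+1 - i by rewrite size_drop size_takel.
  apply: (IH u); rewrite ?szu; [arith|arith|by rewrite drop_uniq ?take_uniq|].
  have nthu k : k < j.+1 - i -> nth x0 u k = nth x0 t (i + k).
    by move=> klt; rewrite nth_drop nth_take //; arith.
  apply/(cycle_nthP x0) => k; rewrite szu => klt.
  have [kl|kl] := eqVneq k (j - i).
    rewrite !nthu //; last by rewrite ltn_mod; arith.
    have -> : k.+1 = j.+1 - i by arith.
    by rewrite modnn addn0 p4midC kl subnKC // ltnW.
  have kl' : k.+1 < j.+1 - i by arith.
  have ikt : (i + k).+1 < size t by arith.
  by rewrite (modn_small kl') !nthu // addnS -(modn_small ikt); apply: ct; exact: ltnW.
have [s4|s4] := eqVneq (size s) 3.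
  case: s s4 us cs {IH sn s3 chordless} => [//|a [//|b [//|c [|//]]]] _ _ /= /and4P[ab bc ca _].
  by apply: (p4mid_triangle_free ab bc); rewrite p4midC.
pose n' := size s.
have [/existsP[i /existsP[j /and4P[ij ji ij0 aij]]]|nochord] := boolP
  [exists i : 'I_n', exists j : 'I_n', [&& i < j, j != i.+1 :> nat,
     ~~ ((i == 0 :> nat) && (j.+1 == n')) & adj (nth x0 s i) (nth x0 s j)]].
  have jn := ltn_ord j; have nmid : ~~ p4mid (nth x0 s i) (nth x0 s j).
    by apply/negP => /(chordless s erefl us cs); rewrite ij jn; arith.
  have nthrot k l : k < n' -> l < n' ->
      nth x0 (rot k s) l = nth x0 s (if k + l < n' then k + l else k + l - n').
    move=> kn ln; rewrite /rot nth_cat size_drop ltn_subRL.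
    case: ifP => kl; first by rewrite nth_drop.
    rewrite nth_take; [congr (nth _ _ _)|]; move: kn ln kl; rewrite /n';
      move: (size s) => N; clear; lia.
  (* Rotating by k puts the dominating vertex at position 0 and the dominated one at l; [kl] is k +
     l modulo the length. *)
  have hub k l : k < n' -> l < n' -> 1 < l -> l.+1 < n' ->
      let kl := if k + l < n' then k + l else k + l - n' in
      adj (nth x0 s kl) (nth x0 s k) -> dominated (nth x0 s kl) (nth x0 s k) -> False.
    move=> kn ln l1 l2 kl akl dkl.
    have E0 : nth x0 (rot k s) 0 = nth x0 s k by rewrite nthrot ?addn0 ?kn //; arith.
    have El : nth x0 (rot k s) l = nth x0 s kl by rewrite nthrot.
    apply: (@p4mid_hub_free x0 (rot k s) l); rewrite ?rot_uniq ?rot_cycle ?E0 ?El ?size_rot //.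
    by move=> i' j'; have := chordless (rot k s); rewrite size_rot rot_uniq rot_cycle; apply.
  have [d|d] := dominated_of_not_p4mid aij nmid.
    have E1 : j + (n' - j + i) < n' = false by arith.
    have E2 : j + (n' - j + i) - n' = i by arith.
    by apply: (hub j (n' - j + i)); rewrite ?E1 ?E2 //; arith.
  apply: (hub i (j - i)) => //; try arith.
    by rewrite subnKC ?jn ?(ltnW ij) // adj_sym.
  by rewrite subnKC ?jn ?(ltnW ij).
(* With no chord in G, the cycle is an induced cycle of G. *)
apply: (chG (n := n')); first by rewrite /n'; arith.
apply: (@induced_of_embedding _ (fun i j => j == i.+1 %% n') _ (nth x0 s)).
split=> [i j ilt jlt /eqP|]; first by rewrite nth_uniq // => /eqP.
have modS := @succn_modn n'.
have cyc i : i < n' -> adj (nth x0 s i) (nth x0 s (i.+1 %% n')).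
  by move=> ilt; apply: p4mid_adj; move/(cycle_nthP x0): cs; apply.
have lt i j : i < j -> j < n' ->
    adj (nth x0 s i) (nth x0 s j) = nat_adj (fun i j => j == i.+1 %% n') i j.
  move=> ij jn; have iN := ltn_trans ij jn; rewrite /nat_adj /= (ltn_eqF ij) /=.
  apply/idP/idP => [aij|/orP[/eqP->|/eqP->]]; [|exact: cyc|by rewrite adj_sym; apply: cyc].
  apply: contraR nochord; rewrite negb_or => /andP[ne1 ne2].
  apply/existsP; exists (Ordinal iN); apply/existsP; exists (Ordinal jn) => /=.
  rewrite ij aij andbT /=; move: ne1 ne2.
  by case: (modS i iN) => -[? ->]; case: (modS j jn) => -[? ->]; arith.
move=> i j; rewrite !inE => ilt jlt; case: (ltngtP i j) => [ij|ji|->]; first exact: lt.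
  by rewrite adj_sym nat_adjC lt.
by rewrite adj_irrefl /nat_adj /= eqxx.
Qed.

(** * From cycles of the Gallai graph to cycles of middle edges *)

Lemma gallai_adj_pair (e f : gallai G) v x : adj e f -> val e = [set v; x] ->
  (exists2 y, val f = [set v; y] & coadj x y) \/
  (exists2 y, val f = [set x; y] & coadj v y).
Proof.
case/andP=> _ /existsP[u /existsP[t /existsP[w /and4P[/eqP -> /eqP -> uw nuw]]]].
by case/set2_eqP=> -[? ?]; subst; [right|left]; exists w => //; exact/andP.
Qed.

Lemma gallai_edge_adj (e : gallai G) v x : val e = [set v; x] -> adj v x.
Proof.
move=> E; have := valP e; rewrite E => /imset2P[y z _]; rewrite inE => /andP[_ yz].
by case/set2_eqP=> -[-> ->]; adj_auto.
Qed.

(* The complement of G[N(v)] being a forest with at most one nontrivial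
   component, any edge in it restricted to a set of neighbours yields two leaves. *)
Lemma coadj_two_leaves v (P : pred G) x y :
  (forall z, P z -> adj v z) -> P x -> P y -> coadj x y ->
  exists x1 x2, x1 != x2 /\
    {in [:: x1; x2], forall t, exists z, [/\ P t, P z, coadj t z &
       forall z', P z' -> coadj t z' -> z' = z]}.
Proof.
move=> Pv.
have leaf_or t z : P t -> P z -> coadj t z ->
    (forall z', P z' -> coadj t z' -> z' = z) \/
    (exists z', [/\ P z', coadj t z' & z' <> z]).
  move=> Pt Pz tz.
  have [/existsP[z' /and3P[? ? /eqP ?]]|no] :=
    boolP [exists z', [&& P z', coadj t z' & z' != z]].
    by right; exists z'.
  left=> z' Pz' tz'; apply/eqP; apply: contraR no => ne.
  by apply/existsP; exists z'; rewrite Pz' tz'.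
(* Given a leaf t at u and another neighbour t' of u, either t' is a leaf or the path t - u - t' - w
   ends in a second leaf w. *)
have branch u t t' : P u -> P t -> P t' -> t <> t' -> coadj u t -> coadj u t' ->
    (forall z, P z -> coadj t z -> z = u) ->
    exists x1 x2, x1 != x2 /\
    {in [:: x1; x2], forall t, exists z, [/\ P t, P z, coadj t z &
       forall z', P z' -> coadj t z' -> z' = z]}.
  move=> Pu Pt Pt' tt' ut ut' lt.
  have t'u : coadj t' u by adj_auto.
  have tu : coadj t u by adj_auto.
  have [lt'|[w [Pw t'w wu]]] := leaf_or t' u Pt' Pu t'u.
    exists t, t'; split; first exact/eqP.
    by move=> s; rewrite !inE => /orP[] /eqP ->; exists u; split.
  have wt' : coadj w t' by adj_auto.
  exists t, w; split; first by apply/eqP => E; subst w; have E' := lt _ Pt' wt'; subst t'; absurd_adj.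
  have lw z : P z -> coadj w z -> z = t'.
    move=> Pz wz; have zw : coadj z w by adj_auto.
    by apply: (@coadj_path_leaf v w t' u t); auto => E; apply: tt'.
  by move=> s; rewrite !inE => /orP[] /eqP ->; [exists u|exists t']; split.
move=> Px Py xy; have yx : coadj y x by adj_auto.
have [lx|[x' [Px' xx' x'y]]] := leaf_or x y Px Py xy; last first.
  have [ly|[y' [Py' yy' y'x]]] := leaf_or y x Py Px yx.
    by apply: (@branch x y x') => // /esym.
  exists x', y'.
  have x'x : coadj x' x by adj_auto. have y'y : coadj y' y by adj_auto.
  have lx' z : P z -> coadj x' z -> z = x.
    move=> Pz x'z; have zx' : coadj z x' by adj_auto.
    by apply: (@coadj_path_leaf v x' x y y'); auto => E; apply: y'x.
  have ly' z : P z -> coadj y' z -> z = y.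
    move=> Pz y'z; have zy' : coadj z y' by adj_auto.
    by apply: (@coadj_path_leaf v y' y x x'); auto => E; apply: x'y.
  split; last by move=> s; rewrite !inE => /orP[] /eqP ->; [exists x|exists y]; split.
  by apply/eqP => E; subst y'; have E' := lx' y Py y'y; subst y; absurd_adj.
have [ly|[y' [Py' yy' y'x]]] := leaf_or y x Py Px yx.
  exists x, y; split; first by case/andP: xy.
  by move=> s; rewrite !inE => /orP[] /eqP ->; [exists y|exists x]; split.
by apply: (@branch y x y') => // /esym.
Qed.

Lemma forest_gallai_of_free : forest (gallai G).
Proof.
move=> s s3 us cs.
pose S u v := [exists e in s, val e == [set u; v]].
have SC u v : S u v -> S v u by rewrite /S setUC.
have Sadj u v : S u v -> adj u v.
  by case/exists_inP=> e _ /eqP; apply: gallai_edge_adj.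
(* These are the v for which the edges in [s] at v span an edge of H_v. *)
pose W := [set v | [exists x, exists y, [&& S v x, S v y & coadj x y]]].
have two e : e \in s -> exists f g, [/\ f \in s, g \in s, f != g & adj e f && adj e g].
  move=> es; have [i t Et] := rot_to es.
  have ct : cycle (@adj (gallai G)) (e :: t) by rewrite -Et rot_cycle.
  have ut : uniq (e :: t) by rewrite -Et rot_uniq.
  have szt : 2 < size (e :: t) by rewrite -Et size_rot.
  have mem f : f \in t -> f \in s by move=> ft; rewrite -(mem_rot i) Et inE ft orbT.
  case: t ct ut szt mem {Et} => [|f [|f' t]] //= /andP[ef cf] /and3P[_ uf _] _ mem.
  exists f, (last f' t); split.
  - by apply: mem; rewrite mem_head.
  - by apply: mem; rewrite inE mem_last orbT.
  - by apply: contraNneq uf => ->; rewrite mem_last.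
  - move: cf; rewrite rcons_path => /and3P[_ _ le]; apply/andP; split=> //.
    exact: etrans (@adj_sym (gallai G) _ _) le.
have [W0|] := boolP (W != set0); last first.
  have [e es] : exists e, e \in s.
    by case: s s3 {us cs S SC Sadj W two} => // e s; exists e; rewrite mem_head.
  have [f [g [fs _ _ /andP[ef _]]]] := two e es.
  rewrite negbK => /eqP W0.
  have := valP e => /imset2P[v x _ _ Ee].
  have [[y Ef xy]|[y Ef vy]] := gallai_adj_pair ef Ee.
    suff : v \in W by rewrite W0 inE.
    rewrite inE; apply/existsP; exists x; apply/existsP; exists y; rewrite xy andbT.
    by apply/andP; split; apply/exists_inP; [exists e|exists f] => //; apply/eqP.
  suff : x \in W by rewrite W0 inE.
  rewrite inE; apply/existsP; exists v; apply/existsP; exists y; rewrite vy andbT.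
  apply/andP; split; apply/exists_inP; [exists e|exists f] => //; apply/eqP => //.
  by rewrite setUC.
suff deg2 : {in W, forall v, exists x y,
    [/\ x \in W, y \in W, x != y & p4mid v x && p4mid v y]}.
  have [s' [s'3 us' cs']] := cycle_of_min_degree2 p4midC p4mid_irrefl W0 deg2.
  exact: p4mid_acyclic s'3 us' cs'.
move=> v; rewrite inE => /existsP[x0 /existsP[y0 /and3P[vx0 vy0 xy0]]].
have [x1 [x2 [x12 leaves]]] := @coadj_two_leaves v (S v) x0 y0 (Sadj v) vx0 vy0 xy0.
have good t : t \in [:: x1; x2] -> t \in W /\ p4mid v t.
  move=> /leaves[z [vt vz tz uz]]; have [e es /eqP Ee] := exists_inP vt.
  (* The edge e = vt has two neighbours on the cycle. Both cannot be attached at v, since the leaf t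
     has only z there; so one is attached at t and provides w. *)
  have [w vw tw] : exists2 w, coadj v w & S t w.
    have [f [g [fs gs fg /andP[ef eg]]]] := two e es.
    have [[y Ef ty]|[w Ef vw]] := gallai_adj_pair ef Ee; last first.
      by exists w => //; apply/exists_inP; exists f => //; apply/eqP.
    have [[y' Eg ty']|[w Eg vw]] := gallai_adj_pair eg Ee; last first.
      by exists w => //; apply/exists_inP; exists g => //; apply/eqP.
    have Ey : y = z by apply: uz => //; apply/exists_inP; exists f => //; apply/eqP.
    have Ey' : y' = z by apply: uz => //; apply/exists_inP; exists g => //; apply/eqP.
    by case/eqP: fg; apply: val_inj; rewrite Ef Eg Ey Ey'.
  split.
    rewrite inE; apply/existsP; exists v; apply/existsP; exists w.
    by rewrite tw vw SC.
  apply/p4midP; split; first exact: Sadj.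
    by exists z; [exact: Sadj|adj_auto].
  by exists w; [exact: Sadj|adj_auto].
have [w1 m1] := good x1 (mem_head _ _).
have [w2 m2] : x2 \in W /\ p4mid v x2 by apply: good; rewrite !inE eqxx orbT.
by exists x1, x2; split=> //; rewrite m1.
Qed.

End ForbiddenPatterns.

Theorem theorem1 (G : sgraph) :
  forest (gallai G) <->
  chordal G /\
  ~ contains_induced G F1 /\ ~ contains_induced G F2 /\
  ~ contains_induced G F3 /\ ~ contains_induced G F4 /\
  ~ contains_induced G F5 /\ ~ contains_induced G F6 /\
  ~ contains_induced G F7 /\ ~ contains_induced G F8 /\
  ~ contains_induced G F9.
Proof.
split=> [forG|[chG [? [? [? [? [? [? [? [? ?]]]]]]]]]].
  by split; [exact: forest_gallai_chordal | exact: forest_gallai_F_free].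
exact: forest_gallai_of_free.
Qed.
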